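(* Let $q$ be a prime power and let $t, n$ be positive integers. Suppose that $S$ is a subset of the points of the projective space $\mathrm{PG}(n,q)$ such that no $t+1$ (distinct) points of $S$ lie on a common line of $\mathrm{PG}(n,q)$. Then $$|S|\,q^{n+1} \leq ex\bigl(q^{n+1}, |S|q^n, \{C_4, \theta_{3,t}\}\bigr).$$
   Context: $\mathrm{PG}(n,q)$ denotes the projective space of (projective) dimension $n$ over the finite field $\mathbb{F}_q$, i.e. the projective space associated with the vector space $\mathbb{F}_q^{n+1}$. For a family $\mathcal{F}$ of graphs, $ex(a,b,\mathcal{F})$ is the maximum number of edges in a bipartite graph whose part sizes are $a$ and $b$ and which contains no graph in $\mathcal{F}$ as a (not necessarily induced) subgraph. $C_4$ is the cycle of length 4. $\theta_{3,t}$ is the theta graph consisting of two vertices joined by $t$ internally vertex-disjoint paths, each with exactly 3 edges. *)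

(* Defs.v *)
From HB Require Import structures.
From mathcomp Require Import all_boot all_order all_algebra finmap.
From mathcomp Require Import boolp.

Set Implicit Arguments.
Unset Strict Implicit.
Unset Printing Implicit Defensive.

(* Finite simple graphs. *)
Record sgraph := SGraph {
  vertex :> finType;
  adj : rel vertex;
  adj_sym : symmetric adj;
  adj_irrefl : irreflexive adj }.

(* [contains G H]: [H] is a not necessarily induced subgraph of [G]. *)
Definition contains (G H : sgraph) : Prop :=
  exists2 f : H -> G, injective f & forall x y, adj x y -> adj (f x) (f y).

Definition C4_rel : rel 'I_4 :=
  fun i j => (j == i.+1 %% 4 :> nat) || (i == j.+1 %% 4 :> nat).

Lemma C4_sym : symmetric C4_rel.
Proof. by move=> i j; rewrite /C4_rel orbC. Qed.

Lemma C4_irrefl : irreflexive C4_rel.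
Proof. by case=> [[|[|[|[|m]]]] lt_m]. Qed.

Definition C4 : sgraph := SGraph C4_sym C4_irrefl.

(* The endpoints of [theta3 t] are [inl false] and [inl true]; its [i]-th path
   is inl false -- inr (i, false) -- inr (i, true) -- inl true. *)
Definition theta3_rel (t : nat) : rel (bool + 'I_t * bool)%type :=
  fun u v => match u, v with
  | inl b, inr (_, c) | inr (_, c), inl b => b == c
  | inr (i, b), inr (j, c) => (i == j) && (b != c)
  | inl _, inl _ => false
  end.

Lemma theta3_sym t : symmetric (@theta3_rel t).
Proof. by case=> [b|[i b]] [c|[j c]] //=; rewrite [i == j]eq_sym [b == c]eq_sym. Qed.

Lemma theta3_irrefl t : irreflexive (@theta3_rel t).
Proof. by case=> [b|[i b]] //=; rewrite !eqxx. Qed.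

Definition theta3 (t : nat) : sgraph := SGraph (@theta3_sym t) (@theta3_irrefl t).

(* The bipartite graph with parts of sizes [a] and [b] and edge set [E]. *)
Definition bip_rel (a b : nat) (E : {set 'I_a * 'I_b}) : rel ('I_a + 'I_b)%type :=
  fun u v => match u, v with
  | inl x, inr y | inr y, inl x => (x, y) \in E
  | _, _ => false
  end.

Lemma bip_sym a b (E : {set 'I_a * 'I_b}) : symmetric (bip_rel E).
Proof. by case=> ? []. Qed.

Lemma bip_irrefl a b (E : {set 'I_a * 'I_b}) : irreflexive (bip_rel E).
Proof. by case. Qed.

Definition bip_graph (a b : nat) (E : {set 'I_a * 'I_b}) : sgraph :=
  SGraph (bip_sym E) (bip_irrefl E).

(* If no bipartite graph at all is [Fam]-free, this maximum is 0; that requires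
   an edgeless graph in [Fam]. *)
Definition bip_ex (a b : nat) (Fam : sgraph -> Prop) : nat :=
  \max_(E : {set 'I_a * 'I_b}
        | `[< forall H, Fam H -> ~ contains (bip_graph E) H >]) #|E|.

(* Points of the projective space PG(n, F): the one-dimensional subspaces of
   F^(n+1); lines are the two-dimensional subspaces. *)
Record pg_point (F : finFieldType) (n : nat) := PGPoint {
  pg_space :> {vspace 'rV[F]_n.+1};
  pg_space_dim : \dim pg_space == 1%N }.

HB.instance Definition _ (F : finFieldType) (n : nat) :=
  [isSub for @pg_space F n].
HB.instance Definition _ (F : finFieldType) (n : nat) :=
  [Choice of pg_point F n by <:].

Definition collinear (F : finFieldType) (n : nat) (T : {fset pg_point F n}) : Prop :=
  exists2 L : {vspace 'rV[F]_n.+1},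
    \dim L = 2 & forall P, P \in T -> (P <= L)%VS.

(* Main.v *)
Require Import Defs.
From mathcomp Require Import all_boot all_order all_algebra finmap.
From mathcomp Require Import boolp.

Set Implicit Arguments.
Unset Strict Implicit.
Unset Printing Implicit Defensive.

Import GRing.Theory.

(** Take as vertices the [q^(n+1)] vectors of [V = F^(n+1)] and the
    [|S| q^n] affine lines of [V] whose direction belongs to [S], adjacency
    being incidence; each vector lies on exactly one line of every direction.
    Two vectors lie on at most one common line, so there is no [C4].  In a
    [theta3 t] joining a vector [x] to a line [l], the [t] lines through [x]
    and the line [l] have pairwise distinct directions, since any two of them
    meet; all these lines lie in one affine plane, so their directions are
    [t + 1] collinear points of [S]. *)

(** Every edge changes sides, so opposite vertices of the cycle share a part; two cases remain,
    according to the part of vertex 0. *)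
Lemma contains_bip_C4 (a b : nat) (E : {set 'I_a * 'I_b}) :
  contains (bip_graph E) C4 ->
  exists x x' y y', [/\ x != x', y != y' &
    [&& (x, y) \in E, (x, y') \in E, (x', y) \in E & (x', y') \in E]].
Proof.
case=> f f_inj f_adj.
pose o k (lt_k4 : k < 4) : C4 := Ordinal lt_k4.
have neq u v : u != v -> f u != f v by rewrite (inj_eq f_inj).
have := f_adj (@o 0 isT) (@o 1 isT) isT.
have := f_adj (@o 1 isT) (@o 2 isT) isT.
have := f_adj (@o 2 isT) (@o 3 isT) isT.
have := f_adj (@o 3 isT) (@o 0 isT) isT.
have := neq (@o 0 isT) (@o 2 isT) isT.
have := neq (@o 1 isT) (@o 3 isT) isT.
case: (f (o 0 _)) => [x|y]; case: (f (o 1 _)) => [x1|y1] //;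
  case: (f (o 2 _)) => [x2|y2] //; case: (f (o 3 _)) => [x3|y3] //=
  n13 n02 e30 e23 e12 e01.
  by exists x, x2, y1, y3; split; rewrite // e01 e30 e12.
by exists x1, x3, y, y2; split; rewrite // e01 e12 e30.
Qed.

Lemma contains_bip_theta3 (a b t : nat) (E : {set 'I_a * 'I_b}) :
  0 < t -> contains (bip_graph E) (theta3 t) ->
  exists x y (p : 'I_t -> 'I_a) (l : 'I_t -> 'I_b),
    injective l /\ forall i, [/\ p i != x, l i != y &
      [&& (x, l i) \in E, (p i, l i) \in E & (p i, y) \in E]].
Proof.
move=> t_gt0 [f f_inj f_adj].
have neq u v : u != v -> f u != f v by rewrite (inj_eq f_inj).
have e1 i c : adj (f (inl c)) (f (inr (i, c))) by apply: f_adj => /=.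
have e2 i c : adj (f (inr (i, c))) (f (inr (i, ~~ c))).
  by apply: f_adj; rewrite /= eqxx; case: c.
(* The ends of the theta graph are joined by a path with 3 edges, hence lie in opposite parts; [c]
   names the end sent to the left one. The path used exists because [0 < t]. *)
have [c [x fx]] : exists c x, f (inl c) = inl x.
  case f0: (f (inl false)) => [x|y]; first by exists false, x.
  have := e1 (Ordinal t_gt0) true; have := e2 (Ordinal t_gt0) false.
  have := e1 (Ordinal t_gt0) false; rewrite f0.
  case: (f (inr (_, false))) => // x1 _ /=.
  case: (f (inr (_, true))) => // y1 _.
  by case f1: (f (inl true)) => [x|//] _; exists true, x.
have fl i : exists l, f (inr (i, c)) = inr l.
  by have := e1 i c; rewrite fx; case: (f _) => // l _; exists l.
have fp i : exists p, f (inr (i, ~~ c)) = inl p.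
  have [l fl_i] := fl i.
  by have := e2 i c; rewrite fl_i; case: (f _) => // p _; exists p.
have [y fy] : exists y, f (inl (~~ c)) = inr y.
  have [p fp_i] := fp (Ordinal t_gt0).
  have := e1 (Ordinal t_gt0) (~~ c); rewrite fp_i.
  by case: (f _) => // y _; exists y.
have [l lE] := choice fl; have [p pE] := choice fp.
exists x, y, p, l; split=> [i j lij|i].
  have /f_inj[] // : f (inr (i, c)) = f (inr (j, c)) by rewrite !lE lij.
have := neq (inr (i, ~~ c)) (inl c) isT.
have := neq (inr (i, c)) (inl (~~ c)) isT.
have := e1 i c; have := e2 i c; have := e1 i (~~ c).
by rewrite fx fy lE pE /= => -> -> ->.
Qed.

Lemma pg_space_vline (F : finFieldType) (n : nat) (P : pg_point F n) u :
  u != 0%R -> u \in pg_space P -> pg_space P = <[u]>%VS.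
Proof.
move=> u0 uP; apply/esym/eqP.
by rewrite eqEdim -memvE uP (eqP (pg_space_dim P)) dim_vline u0.
Qed.

(** A model of the quotient of [F^(n+1)] by [P]: the fibres of [f] are the affine lines of direction
    [P], so vectors of [F^n] can label them. *)
Lemma point_quotient (F : finFieldType) (n : nat) (P : pg_point F n) :
  exists f : 'rV[F]_n.+1 -> 'rV[F]_n,
    forall x y, (f x == f y) = (x - y \in pg_space P)%R.
Proof.
have [u u0 ->] : exists2 u, u != 0%R & pg_space P = <[u]>%VS.
  have u0 : vpick P != 0%R.
    by rewrite vpick0 -dimv_eq0 (eqP (pg_space_dim P)).
  by exists (vpick P); last exact/pg_space_vline/memv_pick.
have [j uj0] : exists j, (u 0 j != 0)%R by apply/rV0Pn.
(* Project along [u] onto the coordinate hyperplane of index [j]. *)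
exists (fun x => \row_i (x 0 (lift j i) - x 0 j / u 0 j * u 0 (lift j i)))%R => x y.
apply/eqP/vlineP => [/rowP fxy | [k /rowP xy]].
  (* The multiplier is forced by coordinate [j], the one that the projection drops. *)
  exists ((x - y) 0 j / u 0 j)%R; apply/rowP => i; rewrite !mxE.
  case: (unliftP j i) => [i'|] ->; last by rewrite divfK.
  have := fxy i'; rewrite !mxE => /(canRL (subrK _)) ->.
  by rewrite !mulrBl addrAC [(_ - _ - _)%R]addrAC subrr add0r addrC.
apply/rowP => i; rewrite !mxE.
have xE m : (x 0 m = y 0 m + k * u 0 m)%R.
  by have := xy m; rewrite !mxE => <-; rewrite [RHS]addrC subrK.
by rewrite !xE mulrDl mulfK // mulrDl opprD addrACA subrr addr0.
Qed.

Section DirectionGraph.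

Variables (t n : nat) (F : finFieldType) (S : {fset pg_point F n}).
Variable quo : S -> 'rV[F]_n.+1 -> 'rV[F]_n.
Hypothesis quoE : forall s x y,
  (quo s x == quo s y) = (x - y \in pg_space (val s))%R.
Variables (a b : nat) (vec : 'I_a -> 'rV[F]_n.+1) (line : 'I_b -> S * 'rV[F]_n).
Hypotheses (vec_bij : bijective vec) (line_bij : bijective line).

(* The pair [(s, w)] encodes the affine line [quo s @^-1 w] of direction [s]. *)
Definition incidence : {set 'I_a * 'I_b} :=
  [set e | quo (line e.2).1 (vec e.1) == (line e.2).2].

(** The label of a line through [x] is the image of [vec x] under the quotient by its direction. *)
Lemma incident_dir_inj x l l' :
  (x, l) \in incidence -> (x, l') \in incidence ->
  (line l).1 = (line l').1 -> l = l'.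
Proof.
rewrite !inE /= => /eqP xl /eqP xl' s_eq; apply: (bij_inj line_bij).
by rewrite [LHS]surjective_pairing [RHS]surjective_pairing -xl -xl' s_eq.
Qed.

Lemma incident_diff x y l :
  (x, l) \in incidence -> (y, l) \in incidence ->
  (vec x - vec y \in pg_space (val (line l).1))%R.
Proof. by rewrite !inE -quoE => /eqP -> /eqP ->. Qed.

Lemma vec_sub_neq0 x y : x != y -> (vec x - vec y != 0)%R.
Proof. by rewrite subr_eq0 (inj_eq (bij_inj vec_bij)). Qed.

(** The nonzero difference of the two vectors spans the direction of any line through both. *)
Lemma incident_uniq x y l l' : x != y ->
  (x, l) \in incidence -> (y, l) \in incidence ->
  (x, l') \in incidence -> (y, l') \in incidence -> l = l'.
Proof.
move=> xy xl yl xl' yl'; apply: (incident_dir_inj xl xl').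
apply/val_inj/val_inj => /=; have u0 := vec_sub_neq0 xy.
rewrite (pg_space_vline u0 (incident_diff xl yl)).
by rewrite -(pg_space_vline u0 (incident_diff xl' yl')).
Qed.

Lemma incidence_C4_free : ~ contains (bip_graph incidence) C4.
Proof.
case/contains_bip_C4=> x [x' [y [y' [xx' /eqP yy' /and4P[e1 e2 e3 e4]]]]].
exact/yy'/(incident_uniq xx').
Qed.

Lemma incidence_theta3_free : 0 < t ->
  (forall T : {fset pg_point F n},
    (T `<=` S)%fset -> #|` T| = t.+1 -> ~ collinear T) ->
  ~ contains (bip_graph incidence) (theta3 t).
Proof.
move=> t_gt0 noT /(contains_bip_theta3 t_gt0)[x [y [p [l [l_inj H]]]]].
(* [None] stands for the line [y] and [Some i] for [l i], which gives [t + 1] indices. *)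
pose dir (i : option 'I_t) : S := (line (if i is Some j then l j else y)).1.
(* The distinct lines [l i] and [y] meet in [p i]. *)
have neq_y i : dir (Some i) <> dir None.
  have [_ /eqP ly /and3P[_ pl py]] := H i.
  by move=> /(incident_dir_inj pl py).
have dir_inj : injective dir.
  case=> [i|] [j|] // dij; last 2 first.
  - by case: (neq_y i).
  - by case: (neq_y j).
  (* The lines [l i] and [l j] meet in [x]. *)
  have [[_ _ /and3P[xi _ _]] [_ _ /and3P[xj _ _]]] := (H i, H j).
  by rewrite (l_inj _ _ (incident_dir_inj xi xj dij)).
pose T := [fset val (dir i) | i : option 'I_t]%fset.
apply: (noT T).
- by apply/fsubsetP => _ /imfsetP[i _ ->]; apply: valP.
- rewrite card_imfset /=; last by move=> i j /val_inj /dir_inj.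
  by rewrite -cardE card_option card_ord.
pose i0 := Ordinal t_gt0; pose D i := pg_space (val (dir i)).
have dimD i : \dim (D i) = 1 by apply/eqP/pg_space_dim.
have xpD i : (vec x - vec (p i) \in D (Some i))%R.
  by have [_ _ /and3P[xi pi _]] := H i; apply: incident_diff.
have DE i : D (Some i) = <[vec x - vec (p i)]>%VS.
  apply: pg_space_vline => //; apply: vec_sub_neq0.
  by have [] := H i; rewrite eq_sym.
exists (D (Some i0) + D None)%VS.
  have dim_le : \dim (D (Some i0) + D None) <= 2.
    by rewrite (leq_trans (dimv_add_leqif _ _)) // !dimD.
  (* Were the sum of dimension at most 1, both summands would equal it, against [neq_y]. *)
  apply/eqP; rewrite eqn_leq dim_le /= ltnNge; apply/negP => dim_le1.
  apply: (neq_y i0); apply/val_inj/val_inj => /=.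
  have D0 : D (Some i0) = (D (Some i0) + D None)%VS.
    by apply/eqP; rewrite eqEdim addvSl dimD.
  have D1 : D None = (D (Some i0) + D None)%VS.
    by apply/eqP; rewrite eqEdim addvSr dimD.
  by rewrite -/(D (Some i0)) D0 -D1.
move=> _ /imfsetP[[i|] _ ->]; last exact: addvSr.
(* Split [x - p i] as [(x - p i0) + (p i0 - p i)]; the second term lies in [D None] because [p i0]
   and [p i] are both on [y]. *)
rewrite -/(D (Some i)) (DE i) -memvE -(subrKA (vec (p i0))) memv_add //.
have [[_ _ /and3P[_ _ pi0]] [_ _ /and3P[_ _ pi]]] := (H i0, H i).
exact: incident_diff pi0 pi.
Qed.

(** A direction and a vector determine one incident pair, the vector with the line through it in
    that direction, and every incident pair arises so. *)
Lemma card_incidence : #|incidence| = #|` S| * #|{: 'rV[F]_n.+1}|.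
Proof.
have [vec' vecK vec'K] := vec_bij; have [line' lineK line'K] := line_bij.
pose flag (z : S * 'rV[F]_n.+1) := (vec' z.2, line' (z.1, quo z.1 z.2)).
have flag_inj : injective flag.
  by move=> [s x] [s' x'] [/(can_inj vec'K) -> /(can_inj line'K)[-> _]].
rewrite cardfE -card_prod -(card_codom flag_inj).
apply: eq_card => -[x l]; rewrite inE /=; apply/eqP/codomP => [xl|[z [-> ->]]].
  exists ((line l).1, vec x); rewrite /flag /= vecK xl -surjective_pairing.
  by rewrite lineK.
by rewrite vec'K line'K.
Qed.

End DirectionGraph.

Theorem theorem1p1 (q t n : nat) (F : finFieldType) (S : {fset pg_point F n})
  (q_prime_power : exists p k : nat, [/\ prime p, 0 < k & q = p ^ k])
  (card_F : #|F| = q)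
  (t_gt0 : 0 < t)
  (n_gt0 : 0 < n)
  (S_no_collinear : forall T : {fset pg_point F n},
    (T `<=` S)%fset -> #|` T| = t.+1 -> ~ collinear T) :
  #|` S| * q ^ n.+1 <= bip_ex (q ^ n.+1) (#|` S| * q ^ n) (fun H => H = C4 \/ H = theta3 t).
Proof.
have [quo quoE] := choice (fun s : S => point_quotient (val s)).
have card_rV m : #|{: 'rV[F]_m}| = q ^ m by rewrite card_mx card_F mul1n.
have card_lines : #|{: S * 'rV[F]_n}| = #|` S| * q ^ n.
  by rewrite card_prod card_rV cardfE.
have ord_bij (A : finType) m : #|A| = m -> exists f : 'I_m -> A, bijective f.
  by move=> <-; exists enum_val; apply: enum_val_bij.
have [vec vec_bij] := ord_bij _ _ (card_rV n.+1).
have [line line_bij] := ord_bij _ _ card_lines.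
rewrite -[q ^ n.+1 in leqLHS]card_rV -(card_incidence quo vec_bij line_bij).
apply: leq_bigmax_cond; apply/asboolP => H [->|->].
  exact: incidence_C4_free.
exact: incidence_theta3_free.
Qed.
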